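(* Let $X,Y_1,\dots,Y_n$ be independent real-valued continuous random variables, and suppose there are finite constants $K_1,\dots,K_n>0$ such that $I(X+Y_i;Y_i)\le\log K_i$, i.e. $h(X+Y_i)\leq h(X)+\log K_i$ for each $i$. Then $$h(X+Y_1+\cdots+Y_n)\leq h(X)+\log(K_1K_2\cdots K_n),$$ equivalently $I(X+Y_1+\cdots+Y_n;\,Y_1+\cdots+Y_n)\leq\log(K_1\cdots K_n)$.
   Context: Standing conventions: random variables are real-valued with densities and all differential entropies $h$ appearing exist and are finite. $I(U;V)=h(U)+h(V)-h(U,V)$ is mutual information; $\log$ is the natural logarithm. *)

(* Defs.v *)
From HB Require Import structures.
From mathcomp Require Import all_boot all_order all_algebra.
From mathcomp Require Import all_classical all_reals all_analysis.
Set Implicit Arguments. Unset Strict Implicit. Unset Printing Implicit Defensive.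
Import Order.TTheory GRing.Theory Num.Theory.
Local Open Scope classical_set_scope.
Local Open Scope ring_scope.

Definition is_density {d} {T : measurableType d} {R : realType}
    (P : probability T R) (X : T -> R) (f : R -> R) : Prop :=
  measurable_fun setT f /\ (forall x, 0 <= f x) /\
  forall A : set R, measurable A ->
    P (X @^-1` A) = (\int[@lebesgue_measure R]_(x in A) (f x)%:E)%E.

Definition has_density {d} {T : measurableType d} {R : realType}
    (P : probability T R) (X : T -> R) : Prop :=
  exists f, is_density P X f.

(* The differential entropy h(X) exists, is finite and equals v:
   X has a density f with f log f Lebesgue-integrable and
   v = - \int f log f  (ln 0 = 0 in MathComp, giving 0 log 0 = 0). *)
Definition diff_entropy {d} {T : measurableType d} {R : realType}
    (P : probability T R) (X : T -> R) (v : R) : Prop :=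
  exists f, is_density P X f /\
    (@lebesgue_measure R).-integrable setT (fun x => (f x * ln (f x))%:E) /\
    v%:E = (- \int[@lebesgue_measure R]_x (f x * ln (f x))%:E)%E.

Definition mutually_independent {d} {T : measurableType d} {R : realType}
    (P : probability T R) (k : nat) (Z : 'I_k -> T -> R) : Prop :=
  (forall i, measurable_fun setT (Z i)) /\
  forall B : 'I_k -> set R, (forall i, measurable (B i)) ->
    P (\bigcap_(i in [set: 'I_k]) (Z i @^-1` B i)) =
    (\prod_(i < k) P (Z i @^-1` B i))%E.

Definition consZ {T R : Type} (n : nat) (X : T -> R) (Y : 'I_n -> T -> R)
    : 'I_n.+1 -> T -> R :=
  fun i => match unlift ord0 i with None => X | Some j => Y j end.

(* Main.v *)
(** Write S_k = Y_1 + ... + Y_k and let f, p_i, q_k be densities of X, X + Y_i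
    and X + S_k. The ratio
      tau_k = q_k(X + S_k) p_(k+1)(X + Y_(k+1)) / (f(X) q_(k+1)(X + S_(k+1)))
    has expectation at most 1: by independence of X, S_k and Y_(k+1), Tonelli
    and translation invariance, E tau_k is bounded by the integral of
    (p_(k+1) * law S_k) (q_k * law Y_(k+1)) / q_(k+1), and both convolutions
    equal q_(k+1) almost everywhere. Summing ln tau_k <= tau_k - 1 over k, the
    terms ln q_k(X + S_k) telescope pointwise before any expectation is taken,
    so the intermediate sums X + S_k need not have finite entropy. *)

Require Import Defs.
From HB Require Import structures.
From mathcomp Require Import all_boot all_order all_algebra.
From mathcomp Require Import all_classical all_reals all_analysis.
From mathcomp Require Import measurable_realfun.
Import Order.TTheory GRing.Theory Num.Theory.
Local Open Scope ring_scope.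

Set Implicit Arguments.
Unset Strict Implicit.
Unset Printing Implicit Defensive.
Local Open Scope classical_set_scope.
Local Open Scope ereal_scope.

(** * Independence *)

(** Rectangles form a pi-system that generates the product sigma-algebra. Finiteness of [m] lets the
    constant sequence [setT] serve as the exhausting sequence in the uniqueness theorem. *)
Lemma finite_prod_measure_ext d1 d2 (T1 : measurableType d1)
    (T2 : measurableType d2) (R : realType)
    (m m' : {measure set (T1 * T2) -> \bar R}) :
  m setT < +oo ->
  (forall A B, measurable A -> measurable B -> m (A `*` B) = m' (A `*` B)) ->
  forall D, measurable D -> m D = m' D.
Proof.
move=> mfin mm' D mD.
apply: (measure_unique
  [set A `*` B | A in (@measurable _ T1) & B in (@measurable _ T2)]
  (fun=> setT)) => //.
- exact: measurable_prod_measurableType.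
- move=> _ _ [A1 mA1 [B1 mB1 <-]] [A2 mA2 [B2 mB2 <-]].
  exists (A1 `&` A2); first exact: measurableI.
  exists (B1 `&` B2); first exact: measurableI.
  by rewrite setXI.
- move=> _; exists setT => //; exists setT => //.
  by apply/seteqP; split.
- by rewrite bigcup_const.
- by move=> _ [A mA [B mB <-]]; exact: mm'.
Qed.

Definition independent2 d d1 d2 (T : measurableType d) (T1 : measurableType d1)
    (T2 : measurableType d2) (R : realType) (P : probability T R)
    (U : T -> T1) (V : T -> T2) :=
  forall A B, measurable A -> measurable B ->
    P (U @^-1` A `&` V @^-1` B) = P (U @^-1` A) * P (V @^-1` B).

Definition independent3 d (T : measurableType d) (R : realType)
    (P : probability T R) (X Y Z : T -> R) :=
  forall A B C, measurable A -> measurable B -> measurable C ->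
    P (X @^-1` A `&` Y @^-1` B `&` Z @^-1` C) =
    P (X @^-1` A) * P (Y @^-1` B) * P (Z @^-1` C).

Section independence.
Context d d1 d2 (T : measurableType d) (T1 : measurableType d1)
  (T2 : measurableType d2) (R : realType) (P : probability T R).

Lemma measurable_preimage (d0 : measure_display) (T0 : measurableType d0)
    (U : T -> T0) (A : set T0) : measurable_fun setT U -> measurable A ->
  measurable (U @^-1` A).
Proof. by move=> mU mA; rewrite -[X in measurable X]setTI; exact: mU. Qed.

(** Both sides are finite measures in [D]: the law of [(U, V)] restricted to [E], and that law
    scaled by [P E]. They agree on rectangles, hence everywhere. This is the passage from rectangles
    to events about [U + V]; [U] and [V] may depend on each other. *)
Lemma independent_pair (E : set T) (U : T -> T1) (V : T -> T2) :
  measurable E -> measurable_fun setT U -> measurable_fun setT V ->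
  (forall A B, measurable A -> measurable B ->
    P (E `&` (U @^-1` A `&` V @^-1` B)) = P E * P (U @^-1` A `&` V @^-1` B)) ->
  forall D : set (T1 * T2), measurable D ->
    P (E `&` (fun t => (U t, V t)) @^-1` D) =
    P E * P ((fun t => (U t, V t)) @^-1` D).
Proof.
move=> mE mU mV EUV D mD.
pose W t := (U t, V t).
have mW : measurable_fun setT W by exact: measurable_fun_pair.
pose W' : {mfun T >-> (T1 * T2)%type} :=
  HB.pack W (isMeasurableFun.Build _ _ _ _ _ mW).
pose r : {nonneg R} := NngNum (fine_ge0 (measure_ge0 P E)).
have rE : r%:num%:E = P E by rewrite /= fineK// fin_num_measure.
pose m' : {measure set (T1 * T2) -> \bar R} := mscale r (distribution P W').
pose m : {measure set (T1 * T2) -> \bar R} := pushforward (mrestr P mE) W'.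
have mE' A : m mW A = P (E `&` W @^-1` A).
  by rewrite /m /= /pushforward /mrestr setIC.
have m'E A : m' A = P E * P (W @^-1` A) by rewrite /m' /= /mscale rE.
rewrite -/W -mE' -m'E; apply: finite_prod_measure_ext => //.
- by rewrite mE' preimage_setT setIT (le_lt_trans (probability_le1 _ _))// ltry.
- by move=> A B mA mB; rewrite mE' m'E; exact: EUV.
Qed.

(** Independence says that the joint law is the product of the marginal laws, after which Tonelli
    applies. Both integrals are pulled back to [P], so that no image measure remains in later
    computations. *)
Lemma ge0_expectation_independent (U : T -> T1) (V : T -> T2)
    (F : T1 * T2 -> \bar R) :
  measurable_fun setT U -> measurable_fun setT V -> independent2 P U V ->
  measurable_fun [set: T1 * T2] F -> (forall z, 0 <= F z) ->
  \int[P]_t F (U t, V t) = \int[P]_t \int[P]_s F (U t, V s).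
Proof.
move=> mU mV iUV mF F0.
pose W t := (U t, V t).
have mW : measurable_fun setT W by exact: measurable_fun_pair.
pose W' : {mfun T >-> (T1 * T2)%type} :=
  HB.pack W (isMeasurableFun.Build _ _ _ _ _ mW).
pose U' : {mfun T >-> T1} := HB.pack U (isMeasurableFun.Build _ _ _ _ _ mU).
pose V' : {mfun T >-> T2} := HB.pack V (isMeasurableFun.Build _ _ _ _ _ mV).
have -> : \int[P]_t F (U t, V t) = \int[distribution P W']_z F z.
  by rewrite ge0_integral_distribution.
rewrite (eq_measure_integral (distribution P U' \x distribution P V'));
  last by move=> A mA _; apply/esym/product_measure_unique.
rewrite fubini_tonelli1//.
rewrite ge0_integral_distribution//; last 2 first.
- exact: measurable_fun_fubini_tonelli_F.
- by move=> x; apply: integral_ge0.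
apply: eq_integral => t _ /=; rewrite /fubini_F ge0_integral_distribution//.
by apply: measurableT_comp => //; exact: pair1_measurable.
Qed.

End independence.

Section independent3_theory.
Context d (T : measurableType d) (R : realType) (P : probability T R).
Implicit Types X Y Z : T -> R.

Lemma independent3_pair X Y Z : measurable_fun setT X ->
  measurable_fun setT Y -> measurable_fun setT Z -> independent3 P X Y Z ->
  independent2 P X (fun t => (Y t, Z t)).
Proof.
move=> mX mY mZ iXYZ A D mA mD; apply: independent_pair => //.
  exact: measurable_preimage.
move=> B C mB mC; rewrite setIA iXYZ//.
(* The case [A = setT] gives the joint probability for [Y] and [Z] as a product. *)
have := iXYZ setT B C measurableT mB mC.
by rewrite preimage_setT setTI probability_setT mul1e => ->; rewrite muleA.
Qed.

Lemma independent3_23 X Y Z : measurable_fun setT X -> independent3 P X Y Z ->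
  independent2 P Y Z.
Proof.
move=> mX iXYZ B C mB mC; have := iXYZ setT B C measurableT mB mC.
by rewrite preimage_setT setTI probability_setT mul1e.
Qed.

Lemma independent3_rot X Y Z : independent3 P X Y Z -> independent3 P Z X Y.
Proof.
move=> iXYZ C A B mC mA mB; have := iXYZ A B C mA mB mC.
by rewrite setIC setIA => ->; rewrite muleC muleA.
Qed.

Lemma independent3_swap X Y Z : independent3 P X Y Z -> independent3 P Y X Z.
Proof.
move=> iXYZ B A C mB mA mC; rewrite [_ `&` X @^-1` _]setIC iXYZ//.
by rewrite [X in X * _ = _]muleC.
Qed.

(** The event that [Y + Z] lies in [B] is the preimage under the pair [(Y, Z)] of a Borel set of the
    plane. *)
Lemma independent3_addr X Y Z : measurable_fun setT X ->
  measurable_fun setT Y -> measurable_fun setT Z -> independent3 P X Y Z ->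
  independent2 P X (fun t => Y t + Z t)%R.
Proof.
move=> mX mY mZ iXYZ A B mA mB.
have mD : measurable ((fun z : R * R => z.1 + z.2)%R @^-1` B).
  by apply: measurable_preimage => //; exact: measurable_funD.
exact: (independent3_pair mX mY mZ iXYZ mA mD).
Qed.

End independent3_theory.

(** * Independence of X, a partial sum and the next summand *)

Section grouping.
Context d (T : measurableType d) (R : realType) (P : probability T R) (n : nat).
Variables (X : T -> R) (Y : 'I_n -> T -> R).
Hypothesis XY : mutually_independent P (consZ X Y).

(** Indices start at 0, so [Y i] is the summand that follows [partial_sum i]. Filtering a sum over
    ['I_n] keeps one index type for every [k]. *)
Definition partial_sum k (t : T) : R := (\sum_(i < n | (i < k)%N) Y i t)%R.

Lemma measurable_consZ_head : measurable_fun setT X.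
Proof. by have [/(_ ord0)] := XY; rewrite /consZ unlift_none. Qed.

Lemma measurable_consZ_tail i : measurable_fun setT (Y i).
Proof. by have [/(_ (lift ord0 i))] := XY; rewrite /consZ liftK. Qed.

Lemma measurable_partial_sum k : measurable_fun setT (partial_sum k).
Proof.
rewrite /partial_sum; under eq_fun do rewrite big_mkcond/=.
apply: measurable_sum => i; case: (i < k)%N => //.
exact: measurable_consZ_tail.
Qed.

Lemma partial_sum0 : partial_sum 0 = cst 0%R.
Proof. by apply/funext => t; rewrite /partial_sum big_pred0. Qed.

Lemma partial_sumS (i : 'I_n) t :
  partial_sum i.+1 t = (partial_sum i t + Y i t)%R.
Proof.
rewrite /partial_sum (bigD1 i)//= addrC; congr +%R.
by apply: eq_bigl => j; rewrite ltnS -val_eqE/= andbC -ltn_neqAle.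
Qed.

(* The variables consumed by the partial sum are unconstrained, so the
   intersection and the product can range over all of 'I_n. *)
Lemma partial_sum_independence k : (k <= n)%N -> forall A B (C : 'I_n -> set R),
  measurable A -> measurable B -> (forall i, measurable (C i)) ->
  (forall i : 'I_n, (i < k)%N -> C i = setT) ->
  P (X @^-1` A `&` \bigcap_i (Y i @^-1` C i) `&` partial_sum k @^-1` B) =
  P (X @^-1` A) * (\prod_(i < n) P (Y i @^-1` C i)) * P (partial_sum k @^-1` B).
Proof.
have mX := measurable_consZ_head; have mY := measurable_consZ_tail.
have mcap (C : 'I_n -> set R) : (forall i, measurable (C i)) ->
    measurable (\bigcap_i (Y i @^-1` C i)).
  move=> mC; apply: fin_bigcap_measurable => // i _.
  exact: measurable_preimage.
elim: k => [_ A B C mA mB mC _|k IH kn A B C mA mB mC CT].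
  (* Base case: mutual independence, applied with [A] at the head and [C] on the tail. *)
  have [_ /(_ (fun i => if unlift ord0 i is Some j then C j else A))] := XY.
  have capE : \bigcap_(i in [set: 'I_n.+1]) (consZ X Y i @^-1`
      (if unlift ord0 i is Some j then C j else A)) =
      X @^-1` A `&` \bigcap_i (Y i @^-1` C i).
    apply/seteqP; split=> [t h|t [tA tC] i _].
      split=> [|i _].
        by have := h ord0 Logic.I; rewrite /consZ unlift_none.
      by have := h (lift ord0 i) Logic.I; rewrite /consZ liftK.
    by rewrite /consZ; case: unlift => [j|//]; exact: tC.
  rewrite capE big_ord_recl /= {1 2}/consZ unlift_none.
  under eq_bigr do rewrite /consZ liftK.
  move=> indep; have {}indep := indep _.
  (* The empty sum is the constant 0, so its event is the whole space or empty according to whether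
     0 lies in [B]. *)
  rewrite partial_sum0; case: (pselect (B 0%R)) => B0.
    rewrite (_ : _ @^-1` B = setT) ?setIT ?probability_setT ?mule1.
      by apply: indep => i; case: unlift.
    by apply/seteqP; split.
  rewrite (_ : _ @^-1` B = set0) ?setI0 ?measure0 ?mule0//.
  by apply/seteqP; split.
pose i0 := Ordinal kn.
have mS := measurable_partial_sum.
(* [C'] leaves [Y i0] free, while the induction hypothesis at [k] still allows a constraint on it.
   Putting [D] there splits off both [partial_sum k] and [Y i0] from the remaining variables, on
   rectangles. *)
have IHD (C' : 'I_n -> set R) A' B' D : measurable A' -> measurable B' ->
    measurable D -> (forall i, measurable (C' i)) ->
    (forall i : 'I_n, (i < k.+1)%N -> C' i = setT) ->
    P (X @^-1` A' `&` \bigcap_i (Y i @^-1` C' i) `&`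
      (partial_sum k @^-1` B' `&` Y i0 @^-1` D)) =
    P (X @^-1` A') * (\prod_(i < n) P (Y i @^-1` C' i)) *
      (P (partial_sum k @^-1` B') * P (Y i0 @^-1` D)).
  move=> mA' mB' mD mC' C'T.
  pose C'' i := if i == i0 then D else C' i.
  have C'i0 : C' i0 = setT by apply: C'T.
  have capC'' : \bigcap_i (Y i @^-1` C'' i) =
      \bigcap_i (Y i @^-1` C' i) `&` Y i0 @^-1` D.
    apply/seteqP; split=> [t h|t [tC tD] i _].
      split=> [i _|]; last by have := h i0 Logic.I; rewrite /C'' eqxx.
      have := h i Logic.I; rewrite /C''; case: eqP => // -> _.
      by rewrite C'i0.
    by rewrite /C''; case: eqP => [->//|_]; exact: tC.
  have prodC'' : \prod_(i < n) P (Y i @^-1` C'' i) =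
      (\prod_(i < n) P (Y i @^-1` C' i)) * P (Y i0 @^-1` D).
    rewrite (bigD1 i0)//= [in RHS](bigD1 i0)//= /C'' eqxx C'i0 preimage_setT.
    rewrite probability_setT mul1e muleC; congr (_ * _).
    by apply: eq_bigr => i /negbTE ->.
  have := IH (ltnW kn) A' B' C'' mA' mB'.
  rewrite capC'' prodC'' => IHC''; rewrite [_ `&` Y i0 @^-1` D]setIC.
  rewrite setIA -[X in P (X `&` _)]setIA IHC''.
  - by rewrite [P (partial_sum _ @^-1` _) * _]muleC !muleA.
  - by move=> i; rewrite /C''; case: ifP.
  - move=> i ik; rewrite /C''; case: eqP => [i_i0|_].
      by move: ik; rewrite i_i0 ltnn.
    by apply: C'T; rewrite ltnS ltnW.
have PE : P (X @^-1` A `&` \bigcap_i (Y i @^-1` C i)) =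
    P (X @^-1` A) * \prod_(i < n) P (Y i @^-1` C i).
  have := IHD C A setT setT mA measurableT measurableT mC CT.
  by rewrite !preimage_setT !setIT !probability_setT !mule1.
have PSY D E : measurable D -> measurable E ->
    P (partial_sum k @^-1` D `&` Y i0 @^-1` E) =
    P (partial_sum k @^-1` D) * P (Y i0 @^-1` E).
  move=> mD mE.
  have := IHD (fun=> setT) setT D E measurableT mD mE (fun=> measurableT)
    (fun _ _ => erefl).
  rewrite preimage_setT probability_setT mul1e big1 // mul1e setTI.
  by rewrite (_ : \bigcap_i _ = setT) ?setTI//; apply/seteqP; split.
rewrite -PE.
(* The next partial sum is a measurable function of the pair, so the product rule extends from
   rectangles to its events. *)
have -> : partial_sum k.+1 @^-1` B = (fun t => (partial_sum k t, Y i0 t)) @^-1`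
    ((fun z : R * R => z.1 + z.2)%R @^-1` B).
  by apply/seteqP; split => t; rewrite /preimage/= -(partial_sumS i0).
apply: independent_pair => //.
- by apply: measurableI; [exact: measurable_preimage|exact: mcap].
- by move=> D E mD mE; rewrite IHD// PE PSY.
- by apply: measurable_preimage => //; exact: measurable_funD.
Qed.

Lemma independent3_partial_sum (i : 'I_n) :
  independent3 P X (partial_sum i) (Y i).
Proof.
move=> A B D mA mB mD.
(* Only [Y i] is constrained; this is permitted at [k = i], since the partial sum stops just before
   that index. *)
pose C j := if j == i then D else setT.
have := partial_sum_independence (ltnW (ltn_ord i)) (C := C) mA mB.
rewrite (_ : \bigcap_j _ = Y i @^-1` D); last first.
  apply/seteqP; split=> [t /(_ i Logic.I)|t tD j _]; first by rewrite /C eqxx.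
  by rewrite /C; case: eqP => [->|].
rewrite (bigD1 i)//= big1 ?mule1; last first.
  by move=> j /negbTE ji; rewrite /C ji preimage_setT probability_setT.
rewrite /C eqxx setIAC muleAC; apply => [j|j ji]; first by case: ifP.
by case: eqP ji => // ->; rewrite ltnn.
Qed.

End grouping.

(** * Densities *)

Section lebesgue_translation.
Context (R : realType).
Local Notation mu := (@lebesgue_measure R).

(** The shifted measure gives every half-open interval its length, which characterises Lebesgue
    measure. *)
Lemma lebesgue_measure_shift (a : R) (A : set R) : measurable A ->
  pushforward mu (fun x : R => x + a)%R A = mu A.
Proof.
move=> mA; have ma : measurable_fun setT (fun x : R => x + a)%R.
  by apply: measurable_funD.
pose m : {measure set (measurableTypeR R) -> \bar R} :=
  pushforward mu ((fun x => x + a)%R : measurableTypeR R -> measurableTypeR R).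
apply/esym/(@lebesgue_measure_unique _ (m ma)) => //= _ [[b c]] _ <-.
rewrite /pushforward.
have -> : (fun x => x + a)%R @^-1` `]b, c] = `](b - a)%R, (c - a)%R]%classic.
  by apply/seteqP; split => x; rewrite /= !in_itv/= ltrBlDr lerBrDr.
by rewrite !lebesgue_measure_itv/= !lte_fin ltrD2r -!EFinB opprB addrA subrK.
Qed.

Lemma ge0_integral_shift (a : R) (f : R -> \bar R) :
  measurable_fun setT f -> (forall x, 0 <= f x) ->
  \int[mu]_x f (x + a)%R = \int[mu]_x f x.
Proof.
move=> mf f0; have ma : measurable_fun setT (fun x : R => x + a)%R.
  by apply: measurable_funD.
transitivity (\int[pushforward mu
  ((fun x => x + a)%R : measurableTypeR R -> measurableTypeR R)]_x f x).
  by rewrite ge0_integral_pushforward.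
by apply: eq_measure_integral => //= A mA _; exact: lebesgue_measure_shift.
Qed.

End lebesgue_translation.

Section density.
Context d (T : measurableType d) (R : realType) (P : probability T R).
Local Notation mu := (@lebesgue_measure R).
Implicit Types (X : T -> R) (f g : R -> R).

Lemma integral_density X f : is_density P X f -> \int[mu]_x (f x)%:E = 1.
Proof. by move=> [_ [_ <-]]//; rewrite preimage_setT probability_setT. Qed.

Lemma integrable_density X f : is_density P X f ->
  mu.-integrable setT (fun x => (f x)%:E).
Proof.
move=> Xf; have [mf [f0 _]] := Xf.
apply/integrableP; split; first exact/measurable_EFinP.
under eq_integral do rewrite gee0_abs ?lee_fin//.
by rewrite (integral_density Xf) ltry.
Qed.

(** Equal integrals over every measurable set force equality almost everywhere. Here [g] is
    extended-real valued so as to cover Radon-Nikodym derivatives and convolutions. *)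
Lemma density_ae_eq X f (g : R -> \bar R) : is_density P X f ->
  measurable_fun setT g ->
  (forall A, measurable A -> P (X @^-1` A) = \int[mu]_(x in A) g x) ->
  ae_eq mu setT (fun x => (f x)%:E) g.
Proof.
move=> Xf mg Xg; apply: integral_ae_eq => //.
  exact: (integrable_density Xf).
by move=> A _ mA; rewrite -Xg//; have [_ [_ <-]] := Xf.
Qed.

(** The law of [X] is absolutely continuous, so the change of variables holds with its Radon-Nikodym
    derivative, and that derivative equals [f] almost everywhere. *)
Lemma ge0_expectation_density X f (g : R -> \bar R) : measurable_fun setT X ->
  is_density P X f -> measurable_fun setT g -> (forall x, 0 <= g x) ->
  \int[P]_t g (X t) = \int[mu]_x (g x * (f x)%:E).
Proof.
move=> mX Xf mg g0; have [mf [f0 fE]] := Xf.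
pose X' : {mfun T >-> measurableTypeR R} :=
  HB.pack X (isMeasurableFun.Build _ _ _ (measurableTypeR R) _ mX).
pose nu : {finite_measure set (measurableTypeR R) -> \bar R} :=
  distribution P X'.
have nuE A : nu A = P (X @^-1` A) by [].
have numu : nu `<< mu.
  apply/null_content_dominatesP => A mA muA0.
  rewrite nuE fE// null_set_integral//.
  exact/measurable_funTS/measurable_EFinP.
have -> : \int[P]_t g (X t) = \int[nu]_x g x.
  by rewrite [RHS](ge0_integral_distribution X').
rewrite -(Radon_Nikodym_SigmaFinite.change_of_variables numu)//.
have mRN := measurable_int _ (Radon_Nikodym_SigmaFinite.f_integrable numu).
apply: ae_eq_integral => //.
- by apply: emeasurable_funM => //; exact: mRN.
- by apply: emeasurable_funM => //; exact/measurable_EFinP.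
apply/ae_eqe_mul2l/ae_eq_sym/(density_ae_eq Xf) => [//|A mA].
exact: (Radon_Nikodym_SigmaFinite.f_integral numu).
Qed.

Lemma probability_density_eq0 X f : measurable_fun setT X -> is_density P X f ->
  P (X @^-1` [set x | f x = 0%R]) = 0.
Proof.
move=> mX [mf [f0 fE]]; rewrite fE.
  by rewrite integral0_eq// => x /= ->.
exact: (measurable_preimage mf (measurable_set1 0%R)).
Qed.

End density.

(** * Entropy as the expectation of a log-density *)

Section entropy.
Context d (T : measurableType d) (R : realType) (P : probability T R).
Local Notation mu := (@lebesgue_measure R).
Implicit Types (X : T -> R) (f g : R -> R).

(** [diff_entropy] hides its own density [g], but any two densities agree almost everywhere, so any
    chosen [f] computes the same entropy. The change of variables covers nonnegative functions only:
    it is applied to the absolute value for integrability and to both signed parts for the value. *)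
Lemma expectation_ln_density X f v : measurable_fun setT X ->
  diff_entropy P X v -> is_density P X f ->
  P.-integrable setT (fun t => (ln (f (X t)))%:E) /\
  \int[P]_t (ln (f (X t)))%:E = (- v)%:E.
Proof.
move=> mX [g [Xg [ig vE]]] Xf.
have [[mf [f0 fE]] [mg [g0 gE]]] := (Xf, Xg).
pose phi (x : R) := (ln (f x))%:E.
have mphi : measurable_fun setT phi.
  by apply/measurable_EFinP; apply: measurableT_comp.
have mh (h : R -> R) : measurable_fun setT h ->
    measurable_fun setT (fun x => (h x * ln (h x))%:E).
  move=> mh; apply/measurable_EFinP; apply: measurable_funM => //.
  exact: measurableT_comp.
have fgE : ae_eq mu setT (fun x => (f x * ln (f x))%:E)
    (fun x => (g x * ln (g x))%:E).
  have := density_ae_eq Xf ((measurable_EFinP _ _).2 mg) gE.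
  by apply: filterS => x /= /[apply] -[->].
have iphi : P.-integrable setT (phi \o X).
  apply/integrableP; split; first exact: measurableT_comp.
  have mabs : measurable_fun setT (fun x => `|phi x|).
    exact: measurableT_comp.
  rewrite (ge0_expectation_density mX Xf mabs)//.
  have [_] := integrableP _ _ _ ig; congr (_ < _); apply: ae_eq_integral => //.
  - by apply: measurableT_comp => //; exact: mh.
  - apply: emeasurable_funM; last exact/measurable_EFinP.
    exact: mabs.
  - apply: filterS fgE => x /= /[apply] [] [<-].
    by rewrite normrM EFinM muleC (ger0_norm (f0 x)).
split => //.
(* Multiplication by the nonnegative [f x] commutes with taking positive and negative parts. *)
have posE (x : R) : phi^\+ x * (f x)%:E = (fun x => (f x * ln (f x))%:E)^\+ x.
  by rewrite !funeposE /phi maxe_pMl ?lee_fin// mul0e -EFinM mulrC.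
have negE (x : R) : phi^\- x * (f x)%:E = (fun x => (f x * ln (f x))%:E)^\- x.
  by rewrite !funenegE /phi maxe_pMl ?lee_fin// mul0e mulNe -EFinM mulrC.
transitivity (\int[mu]_x (f x * ln (f x))%:E); last first.
  rewrite EFinN vE oppeK.
  by apply: ae_eq_integral => //; exact: mh.
rewrite integralE [RHS]integralE; congr (_ - _).
- under [RHS]eq_integral do rewrite -posE.
  rewrite -(ge0_expectation_density mX Xf)//; last exact: measurable_funepos.
  by apply: eq_integral => t _; rewrite !funeposE.
- under [RHS]eq_integral do rewrite -negE.
  rewrite -(ge0_expectation_density mX Xf)//; last exact: measurable_funeneg.
  by apply: eq_integral => t _; rewrite !funenegE.
Qed.

End entropy.

(** * Convolutions *)

Section convolution_density.
Context d (T : measurableType d) (R : realType) (P : probability T R).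
Local Notation mu := (@lebesgue_measure R).

Lemma fubini_lebesgue (h : T -> R -> \bar R) :
  measurable_fun [set: T * R] (fun z => h z.1 z.2) ->
  (forall t x, 0 <= h t x) ->
  \int[P]_t \int[mu]_x h t x = \int[mu]_x \int[P]_t h t x.
Proof.
move=> mh h0.
exact: (@fubini_tonelli _ _ T (measurableTypeR R) R P mu (fun z => h z.1 z.2)).
Qed.

Lemma measurable_integral_param (h : T -> R -> \bar R) :
  measurable_fun [set: T * R] (fun z => h z.1 z.2) ->
  (forall t x, 0 <= h t x) ->
  measurable_fun [set: R] (fun x => \int[P]_t h t x).
Proof.
move=> mh h0; exact: (@measurable_fun_fubini_tonelli_G _ _ T R R P
  (fun z => h z.1 z.2)).
Qed.

Lemma measurable_sub_rv (q : R -> R) (V : T -> R) : measurable_fun setT q ->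
  measurable_fun setT V ->
  measurable_fun [set: T * R] (fun z => q (z.2 - V z.1)%R).
Proof.
move=> mq mV; apply: measurableT_comp => //; apply: measurable_funB => //.
exact: measurableT_comp.
Qed.

(** The convolution of [q] with the law of [V], as an expectation. It takes extended-real values
    because the integral may be infinite at some points. *)
Definition convolution (q : R -> R) (V : T -> R) (x : R) :=
  \int[P]_t (q (x - V t)%R)%:E.

Section conv_theory.
Variables (U V : T -> R) (q : R -> R).
Hypotheses (mU : measurable_fun setT U) (mV : measurable_fun setT V).
Hypotheses (VU : independent2 P V U) (Uq : is_density P U q).

Lemma conv_ge0 x : 0 <= convolution q V x.
Proof. by apply: integral_ge0 => t _; rewrite lee_fin; case: Uq => _ []. Qed.

Lemma measurable_conv : measurable_fun setT (convolution q V).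
Proof.
have [mq [q0 _]] := Uq; apply: measurable_integral_param => [|t x].
  by apply/measurable_EFinP; exact: (measurable_sub_rv mq mV).
by rewrite lee_fin.
Qed.

(** Write the probability as the expectation of an indicator, freeze [V] by independence, integrate
    [U] against [q], translate by [V], and exchange the integrals. *)
Lemma probability_add_conv A : measurable A ->
  P ((fun t => U t + V t)%R @^-1` A) = \int[mu]_(x in A) convolution q V x.
Proof.
move=> mA; have [mq [q0 _]] := Uq.
have mUV : measurable_fun setT (fun t => U t + V t)%R by exact: measurable_funD.
have mqV t : measurable_fun [set: R] (fun x => (q (x - V t)%R)%:E).
  apply/measurable_EFinP; apply: (@measurableT_comp _ _ _ _ _ _ q) => //.
  exact: measurable_funB.
transitivity (\int[P]_t (\1_A (U t + V t)%R)%:E).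
  rewrite (_ : (fun t => _) = (fun t =>
    (\1_((fun t => U t + V t)%R @^-1` A) t)%:E))// integral_indic// ?setIT//.
  exact: measurable_preimage.
have mF : measurable_fun [set: R * R] (fun z => (\1_A (z.2 + z.1)%R : R)%:E).
  apply/measurable_EFinP; apply: measurableT_comp => //.
  exact: measurable_funD.
rewrite (ge0_expectation_independent mV mU VU mF)/=; last first.
  by move=> z; rewrite lee_fin.
transitivity (\int[P]_t \int[mu]_x ((\1_A x)%:E * (q (x - V t)%R)%:E)).
  apply: eq_integral => t _.
  rewrite (ge0_expectation_density (g := fun x => (\1_A (x + V t)%R)%:E)
    mU Uq)//=.
  - rewrite -[RHS](ge0_integral_shift (V t)); last 2 first.
    + by apply: emeasurable_funM => //; exact/measurable_EFinP.
    + by move=> x; rewrite mule_ge0// lee_fin.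
    by apply: eq_integral => x _; rewrite addrK.
  - apply/measurable_EFinP; apply: measurableT_comp => //.
    exact: measurable_funD.
rewrite fubini_lebesgue; last 2 first.
- apply: emeasurable_funM; last first.
    by apply/measurable_EFinP; exact: (measurable_sub_rv mq mV).
  by apply/measurable_EFinP; apply: measurableT_comp.
- by move=> t x; rewrite mule_ge0// lee_fin.
rewrite [RHS]integral_mkcond; apply: eq_integral => x _.
rewrite ge0_integralZl//; last 2 first.
- apply/measurable_EFinP; apply: (@measurableT_comp _ _ _ _ _ _ q) => //.
  exact: measurable_funB.
- by move=> t _; rewrite lee_fin.
by rewrite epatch_indic muleC.
Qed.

Lemma conv_integrable : mu.-integrable setT (convolution q V).
Proof.
apply/integrableP; split; first exact: measurable_conv.
under eq_integral do rewrite gee0_abs ?conv_ge0//.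
by rewrite -probability_add_conv// preimage_setT probability_setT ltry.
Qed.

(** A density must be real valued. The convolution is integrable, hence finite almost everywhere, so
    [fine] alters it only on a null set. *)
Lemma conv_has_density : has_density P (fun t => U t + V t)%R.
Proof.
exists (fine \o convolution q V).
have mc : measurable_fun setT (fine \o convolution q V).
  exact: (measurableT_comp _ measurable_conv).
split => //; split => [x|A mA]; first by rewrite fine_ge0// conv_ge0.
rewrite probability_add_conv//; apply: ae_eq_integral => //.
- by apply: measurable_funTS; exact: measurable_conv.
- exact/measurable_funTS/measurable_EFinP.
have := integrable_ae measurableT conv_integrable.
by apply: filterS => x /(_ Logic.I) xfin _; rewrite /= fineK.
Qed.

Lemma density_add_ae_eq r : is_density P (fun t => U t + V t)%R r ->
  ae_eq mu setT (fun x => (r x)%:E) (convolution q V).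
Proof.
move=> UVr; apply: (density_ae_eq UVr); first exact: measurable_conv.
exact: probability_add_conv.
Qed.

End conv_theory.
End convolution_density.

(** * The entropy inequality *)

(** On nonnegative reals the inverse is the power with exponent -1, including at 0, where both are
    0. *)
Lemma measurable_fun_inv_ge0 d (T : measurableType d) (R : realType)
    (f : T -> R) : (forall x, 0 <= f x)%R ->
  measurable_fun setT f -> measurable_fun setT (fun x => (f x)^-1)%R.
Proof.
move=> f0 mf; under eq_fun do rewrite -powR_inv1//.
exact: (measurableT_comp (measurable_powR _)).
Qed.

(** * The density ratio has expectation at most 1 *)

Section ratio.
Context d (T : measurableType d) (R : realType) (P : probability T R).
Local Notation mu := (@lebesgue_measure R).
Variables (X S Y : T -> R) (f q p r : R -> R).
Hypotheses (mX : measurable_fun setT X) (mS : measurable_fun setT S)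
  (mY : measurable_fun setT Y) (XSY : independent3 P X S Y).
Hypotheses (Xf : is_density P X f)
  (Xq : is_density P (fun t => X t + S t)%R q)
  (Xp : is_density P (fun t => X t + Y t)%R p)
  (Xr : is_density P (fun t => X t + (S t + Y t))%R r).

(** For fixed [x] the independence of [S] and [Y] factors the expectation, and each factor is a
    convolution representing the density of [X + S + Y]. *)
Lemma density_ratio_conv x :
  \int[P]_t (q (x - Y t) * p (x - S t) / r x)%:E =
  convolution P p S x * (convolution P q Y x * ((r x)^-1)%:E).
Proof.
have [[mq [q0 _]] [mp [p0 _]]] := (Xq, Xp); have [mr [r0 _]] := Xr.
have SY : independent2 P S Y by exact: independent3_23 XSY.
have mqx : measurable_fun [set: R] (fun y => q (x - y))%R.
  by apply: measurableT_comp => //; exact: measurable_funB.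
have mpx : measurable_fun [set: R] (fun y => p (x - y))%R.
  by apply: measurableT_comp => //; exact: measurable_funB.
have mF : measurable_fun [set: R * R]
    (fun z => (q (x - z.2) * p (x - z.1) / r x)%:E).
  apply/measurable_EFinP; apply: measurable_funM => //.
  by apply: measurable_funM;
    [exact: (measurableT_comp mqx)|exact: (measurableT_comp mpx)].
rewrite (ge0_expectation_independent mS mY SY mF)/=; last first.
  by move=> z; rewrite lee_fin divr_ge0// mulr_ge0.
rewrite /convolution -ge0_integralZr//; last 3 first.
- by apply/measurable_EFinP; exact: (measurableT_comp mpx).
- by move=> t _; rewrite lee_fin.
- rewrite mule_ge0 ?lee_fin ?invr_ge0//.
  by apply: integral_ge0 => t _; rewrite lee_fin.
apply: eq_integral => t _.
rewrite -ge0_integralZr//; last 3 first.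
- by apply/measurable_EFinP; exact: (measurableT_comp mqx).
- by move=> s _; rewrite lee_fin.
- by rewrite lee_fin invr_ge0.
rewrite -ge0_integralZl//; last 3 first.
- apply/measurable_EFinP; apply: measurable_funM => //.
  exact: (measurableT_comp mqx).
- by move=> s _; rewrite mule_ge0 ?lee_fin ?invr_ge0.
- by rewrite lee_fin.
by apply: eq_integral => s _; rewrite -!EFinM mulrA (mulrC (p _)).
Qed.

Lemma expectation_density_ratio_le1 :
  \int[P]_t (q (X t + S t) * p (X t + Y t) /
             (f (X t) * r (X t + (S t + Y t))))%:E <= 1.
Proof.
have [[mf [f0 _]] [mq [q0 _]]] := (Xf, Xq).
have [[mp [p0 _]] [mr [r0 _]]] := (Xp, Xr).
have mri := measurable_fun_inv_ge0 r0 mr.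
have mfi := measurable_fun_inv_ge0 f0 mf.
have mSY : measurable_fun setT (fun t => (S t, Y t)).
  exact: measurable_fun_pair.
have XSY2 := independent3_pair mX mS mY XSY.
pose H x y z : R := (q (x + y) * p (x + z) / r (x + (y + z)))%R.
have H0 x y z : (0 <= H x y z)%R by rewrite /H divr_ge0// mulr_ge0.
have mH : measurable_fun [set: R * (R * R)] (fun w => H w.1 w.2.1 w.2.2).
  apply: measurable_funM; first apply: measurable_funM.
  - apply: (measurableT_comp mq); apply: measurable_funD => //.
    exact: measurableT_comp.
  - apply: (measurableT_comp mp); apply: measurable_funD => //.
    exact: measurableT_comp.
  - apply: (measurableT_comp mri); apply: measurable_funD => //.
    by apply: measurable_funD; exact: measurableT_comp.
have -> : \int[P]_t (q (X t + S t) * p (X t + Y t) /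
             (f (X t) * r (X t + (S t + Y t))))%:E =
    \int[P]_t (H (X t) (S t) (Y t) / f (X t))%:E.
  by apply: eq_integral => t _; rewrite /H invfM mulrA mulrAC.
have mF : measurable_fun [set: R * (R * R)]
    (fun w => (H w.1 w.2.1 w.2.2 / f w.1)%:E).
  apply/measurable_EFinP; apply: measurable_funM => //.
  exact: (measurableT_comp mfi).
rewrite (ge0_expectation_independent mX mSY XSY2 mF)/=; last first.
  by move=> w; rewrite lee_fin divr_ge0.
have mHT : measurable_fun [set: T * R] (fun w => H w.2 (S w.1) (Y w.1)).
  have mpair : measurable_fun [set: T * R] (fun w => (w.2, (S w.1, Y w.1))).
    by apply: measurable_fun_pair => //; exact: (measurableT_comp mSY).
  exact: (measurableT_comp mH mpair).
have mHf : measurable_fun [set: R]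
    (fun x => \int[P]_t (H x (S t) (Y t) / f x)%:E).
  apply: measurable_integral_param => [|t x]; last by rewrite lee_fin divr_ge0.
  apply/measurable_EFinP; apply: measurable_funM => //.
  exact: (measurableT_comp mfi).
rewrite (ge0_expectation_density mX Xf mHf); last first.
  by move=> x; apply: integral_ge0 => t _; rewrite lee_fin divr_ge0.
have mHx x : measurable_fun setT (fun t => H x (S t) (Y t)).
  exact: (measurableT_comp mHT (pair2_measurable x)).
(* The density [f] of [X] cancels the division by [f x]. Where [f x = 0] the left side is 0, so only
   an inequality is available. *)
apply: (@le_trans _ _ (\int[mu]_x \int[P]_t (H x (S t) (Y t))%:E)).
  apply: ge0_le_integral => //.
  - move=> x _; rewrite mule_ge0 ?lee_fin//.
    by apply: integral_ge0 => t _; rewrite lee_fin divr_ge0.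
  - by apply: emeasurable_funM => //; exact/measurable_EFinP.
  - apply: measurable_integral_param => [|t x]; last by rewrite lee_fin.
    exact/measurable_EFinP.
  move=> x _; rewrite -ge0_integralZr ?lee_fin//; last 2 first.
  - by apply/measurable_EFinP; apply: measurable_funM.
  - by move=> t _; rewrite lee_fin divr_ge0.
  apply: ge0_le_integral => //.
  - by move=> t _; rewrite -EFinM lee_fin mulr_ge0// divr_ge0.
  - apply/measurable_EFinP; apply: measurable_funM => //.
    exact: measurable_funM.
  - exact/measurable_EFinP.
  move=> t _; rewrite -EFinM lee_fin; have [->|fx0] := eqVneq (f x) 0%R.
    by rewrite mulr0.
  by rewrite divfK.
rewrite -(@fubini_lebesgue _ _ _ P (fun t x => (H x (S t) (Y t))%:E));
  last 2 first.
- exact/measurable_EFinP.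
- by move=> t x; rewrite lee_fin.
have mG : measurable_fun [set: T * R]
    (fun w => (q (w.2 - Y w.1) * p (w.2 - S w.1) / r w.2)%R).
  apply: measurable_funM.
    by apply: measurable_funM; [exact: (measurable_sub_rv mq mY)|
                                exact: (measurable_sub_rv mp mS)].
  exact: (measurableT_comp mri).
(* Substituting [x - (S + Y)] for [x] turns [x + S] into [x - Y], [x + Y] into [x - S], and frees
   the argument of [r] from [S] and [Y]. *)
have -> : \int[P]_t \int[mu]_x (H x (S t) (Y t))%:E =
    \int[P]_t \int[mu]_x (q (x - Y t) * p (x - S t) / r x)%:E.
  apply: eq_integral => t _.
  rewrite -[RHS](ge0_integral_shift (S t + Y t)%R); last 2 first.
  - apply/measurable_EFinP.
    exact: (measurableT_comp mG (pair1_measurable t)).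
  - by move=> x; rewrite lee_fin divr_ge0// mulr_ge0.
  apply: eq_integral => x _; rewrite /H.
  have -> : (x + (S t + Y t) - Y t = x + S t)%R by rewrite addrA addrK.
  have -> : (x + (S t + Y t) - S t = x + Y t)%R.
    by rewrite (addrC (S t)) addrA addrK.
  by [].
rewrite (@fubini_lebesgue _ _ _ P
  (fun t x => (q (x - Y t) * p (x - S t) / r x)%:E)); last 2 first.
- exact/measurable_EFinP.
- by move=> t x; rewrite lee_fin divr_ge0// mulr_ge0.
under eq_integral do rewrite density_ratio_conv.
have mXS : measurable_fun setT (fun t => X t + S t)%R by exact: measurable_funD.
have mXY : measurable_fun setT (fun t => X t + Y t)%R by exact: measurable_funD.
have SXY := independent3_addr mS mX mY (independent3_swap XSY).
have YXS := independent3_addr mY mX mS (independent3_rot XSY).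
(* [X + S + Y] is grouped in two ways, as [(X + Y) + S] here and as [(X + S) + Y] below. *)
have rp : ae_eq mu setT (fun x => (r x)%:E) (convolution P p S).
  apply: (density_add_ae_eq mXY mS SXY Xp).
  by under eq_fun do rewrite -addrA [(Y _ + _)%R]addrC.
have rq : ae_eq mu setT (fun x => (r x)%:E) (convolution P q Y).
  apply: (density_add_ae_eq mXS mY YXS Xq).
  by under eq_fun do rewrite -addrA.
have mpS := measurable_conv mS Xp; have mqY := measurable_conv mY Xq.
rewrite (_ : \int[mu]_x _ =
    \int[mu]_x ((r x)%:E * ((r x)%:E * ((r x)^-1)%:E))); last first.
  apply: ae_eq_integral => //.
  - apply: emeasurable_funM => //; apply: emeasurable_funM => //.
    exact/measurable_EFinP.
  - by do 2 (apply: emeasurable_funM; first exact/measurable_EFinP);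
      exact/measurable_EFinP.
  - apply: filterS2 rp rq => x rpx rqx _.
    by rewrite -(rpx Logic.I) -(rqx Logic.I).
(* The integrand [r * (r * r^-1)] equals [r], also at zeros of [r], where both vanish; the integral
   of [r] is 1. *)
rewrite -(integral_density Xr); apply: ge0_le_integral => //.
- by move=> x _; rewrite !mule_ge0 ?lee_fin ?invr_ge0.
- by do 2 (apply: emeasurable_funM; first exact/measurable_EFinP);
    exact/measurable_EFinP.
- exact/measurable_EFinP.
- move=> x _; rewrite -!EFinM lee_fin.
  have [->|rx0] := eqVneq (r x) 0%R; first by rewrite mul0r.
  by rewrite divff// mulr1.
Qed.

End ratio.

Lemma ae_integral_ge0 d (T : measurableType d) (R : realType)
    (m : {measure set T -> \bar R}) (g : T -> \bar R) :
  measurable_fun setT g -> (\forall t \ae m, 0 <= g t) -> 0 <= \int[m]_t g t.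
Proof.
move=> mg g0; rewrite (ae_eq_integral (fun t => `|g t|))//.
- exact: integral_ge0.
- exact: measurableT_comp.
- by apply: filterS g0 => t gt0 _; rewrite gee0_abs.
Qed.

Lemma ln_prod (R : realType) n (K : 'I_n -> R) : (forall i, 0 < K i)%R ->
  ln (\prod_(i < n) K i)%R = (\sum_(i < n) ln (K i))%R.
Proof.
move=> K0; suff [] : (0 < \prod_(i < n) K i /\
  ln (\prod_(i < n) K i) = \sum_(i < n) ln (K i))%R by [].
apply: (big_ind2 (fun x y => 0 < x /\ ln x = y)%R).
- by rewrite ln1.
- by move=> x1 x2 y1 y2 [x0 <-] [y0 <-]; rewrite mulr_gt0// lnM.
- by move=> i _.
Qed.

(** The exceptional event is [f(X) = 0], whose probability is the integral of [f] over its own zero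
    set. Positivity is needed for the logarithm laws, since [ln 0 = 0] by convention. *)
Lemma density_gt0_ae d (T : measurableType d) (R : realType)
    (P : probability T R) (X : T -> R) (f : R -> R) : measurable_fun setT X ->
  is_density P X f -> \forall t \ae P, (0 < f (X t))%R.
Proof.
move=> mX Xf; have [mf [f0 _]] := Xf.
exists (X @^-1` [set x | f x = 0%R]); split.
- apply: (measurable_preimage mX).
  exact: (measurable_preimage mf (measurable_set1 0%R)).
- exact: (probability_density_eq0 mX Xf).
- by move=> t /= /negP; rewrite lt_neqAle f0 andbT negbK => /eqP <-.
Qed.

(** Each independent summand convolves the previous density with its law. This supplies the
    intermediate densities without assuming that their entropies are finite. *)
Lemma partial_sum_has_density d (T : measurableType d) (R : realType)
    (P : probability T R) n (X : T -> R) (Y : 'I_n -> T -> R) k :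
  mutually_independent P (consZ X Y) -> has_density P X -> (k <= n)%N ->
  has_density P (fun t => X t + partial_sum Y k t)%R.
Proof.
move=> XY dX; have mX := measurable_consZ_head XY.
elim: k => [_|k IH kn].
  by rewrite partial_sum0; under eq_fun do rewrite addr0.
have [q Xq] := IH (ltnW kn); pose i := Ordinal kn.
have mY := measurable_consZ_tail XY i.
have mS := measurable_partial_sum XY k.
under eq_fun do rewrite (partial_sumS Y i) addrA.
apply: (conv_has_density _ mY _ Xq); first exact: measurable_funD.
apply: (independent3_addr mY mX mS).
exact/independent3_rot/(independent3_partial_sum XY i).
Qed.

(** This is [ln u <= u - 1] at [u = a * b / (c * e)]. *)
Lemma ln_ratio_le (R : realType) (a b c e : R) :
  (0 < a -> 0 < b -> 0 < c -> 0 < e ->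
   ln a + ln b - ln c - ln e <= a * b / (c * e) - 1)%R.
Proof.
move=> a0 b0 c0 e0; rewrite -addrA -opprD -!lnM// -ln_div ?posrE ?mulr_gt0//.
rewrite -[X in (ln X)](subrK 1%R) addrC; apply: le_ln1Dx.
by rewrite ltrBrDl subrr divr_gt0// mulr_gt0.
Qed.

Local Close Scope ereal_scope.

Theorem mainTheorem11 (d : measure_display) (T : measurableType d)
    (R : realType) (P : probability T R) (n : nat)
    (X : T -> R) (Y : 'I_n -> T -> R) (K : 'I_n -> R)
    (hX : R) (hXY : 'I_n -> R) (hS : R) :
  mutually_independent P (consZ X Y) ->
  has_density P X ->
  (forall i, has_density P (Y i)) ->
  (forall i, 0 < K i) ->
  diff_entropy P X hX ->
  (forall i, diff_entropy P (fun t => X t + Y i t) (hXY i)) ->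
  diff_entropy P (fun t => X t + \sum_(i < n) Y i t) hS ->
  (forall i, hXY i <= hX + ln (K i)) ->
  hS <= hX + ln (\prod_(i < n) K i).
Proof.
move=> XY dX _ K0 HX HXY HS hK.
have mX := measurable_consZ_head XY; have mY := measurable_consZ_tail XY.
pose S := partial_sum Y; have mS k : measurable_fun setT (S k).
  exact: measurable_partial_sum XY k.
have mXS k : measurable_fun setT (fun t => X t + S k t).
  exact: measurable_funD.
have mXY i : measurable_fun setT (fun t => X t + Y i t).
  exact: measurable_funD.
have [f [Xf _]] := HX.
have /choice[p Xp] : forall i, exists p, is_density P (fun t => X t + Y i t) p.
  by move=> i; have [p [Xp _]] := HXY i; exists p.
have /choice[q Xq] : forall k : 'I_n.+1,
    exists q, is_density P (fun t => X t + S k t) q.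
  by move=> k; apply: partial_sum_has_density => //; rewrite -ltnS.
(* [inord] lets [a] be indexed by naturals, as telescoping requires; it is faithful for [k <= n]. *)
pose a k t := ln (q (inord k) (X t + S k t)).
pose b i t := ln (p i (X t + Y i t)).
pose c t := ln (f (X t)).
pose tau (i : 'I_n) t := q (inord i) (X t + S i t) * p i (X t + Y i t) /
  (f (X t) * q (inord i.+1) (X t + S i.+1 t)).
have Xqk k : (k <= n)%N -> is_density P (fun t => X t + S k t) (q (inord k)).
  by move=> kn; have := Xq (inord k); rewrite inordK.
have S0 : S 0 = cst 0 by exact: partial_sum0.
(* Only the endpoints [a 0] and [a n] are integrated: they belong to [X] and to the full sum, whose
   entropies are finite. *)
have [ia0 Ea0] : P.-integrable setT (fun t => (a 0 t)%:E) /\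
    (\int[P]_t (a 0 t)%:E = (- hX)%:E)%E.
  apply: expectation_ln_density => //; last exact: Xqk.
  by rewrite S0; under eq_fun do rewrite addr0.
have [ian Ean] : P.-integrable setT (fun t => (a n t)%:E) /\
    (\int[P]_t (a n t)%:E = (- hS)%:E)%E.
  apply: expectation_ln_density => //; last exact: Xqk.
  rewrite (_ : (fun t => _) = (fun t => X t + \sum_(i < n) Y i t))//.
  by apply/funext => t; congr (_ + _); apply: eq_bigl => i; rewrite ltn_ord.
have Eb i := expectation_ln_density (mXY i) (HXY i) (Xp i).
have [ic Ec] := expectation_ln_density mX HX Xf.
have mtau i : measurable_fun setT (tau i).
  have mcomp (g : R -> R) Z : is_density P Z g -> measurable_fun setT Z ->
    measurable_fun setT (fun t => g (Z t)).
    by move=> [mg _] mZ; exact: measurableT_comp.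
  apply: measurable_funM.
    apply: measurable_funM; first exact: mcomp (Xqk i (ltnW (ltn_ord i))) _.
    exact: mcomp (Xp i) _.
  apply: measurable_fun_inv_ge0 => [t|].
    by rewrite mulr_ge0//; [case: Xf => _ []|case: (Xqk i.+1) => // _ []].
  apply: measurable_funM; first exact: mcomp Xf _.
  exact: mcomp (Xqk i.+1 _) _.
have tau0 i t : 0 <= tau i t.
  apply: divr_ge0; apply: mulr_ge0.
  - by case: (Xqk i (ltnW (ltn_ord i))) => _ [].
  - by case: (Xp i) => _ [].
  - by case: Xf => _ [].
  - by case: (Xqk i.+1) => // _ [].
have Etau i : (\int[P]_t (tau i t)%:E <= 1)%E.
  rewrite /tau /S; under eq_integral do rewrite (partial_sumS Y i).
  apply: (expectation_density_ratio_le1 mX (mS i) (mY i)) => //.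
  - exact: independent3_partial_sum XY i.
  - exact: Xqk (ltnW (ltn_ord i)).
  - have := Xqk i.+1 (ltn_ord i).
    by under eq_fun do rewrite /S (partial_sumS Y i).
have itau i : P.-integrable setT (fun t => (tau i t)%:E).
  apply/integrableP; split; first exact/measurable_EFinP.
  under eq_integral do rewrite gee0_abs ?lee_fin//.
  exact: le_lt_trans (Etau i) (ltry _).
(* [W] is the already telescoped sum of the [ln (tau i)], built from integrable terms only; [Z] is
   the corresponding sum of [tau i - 1]. *)
pose W t := ((a 0 t)%:E - (a n t)%:E + \sum_(i < n) ((b i t)%:E - (c t)%:E))%E.
pose Z t := (\sum_(i < n) ((tau i t)%:E - cst 1 t))%E.
have ibc i : P.-integrable setT (fun t => (b i t)%:E - (c t)%:E)%E.
  by apply: integrableB => //; have [] := Eb i.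
have iW : P.-integrable setT W.
  by apply: integrableD => //; [exact: integrableB|exact: integrable_sum].
have i1 : P.-integrable setT (cst 1%E).
  exact: finite_measure_integrable_cst.
have itau1 i : P.-integrable setT (fun t => (tau i t)%:E - cst 1 t)%E.
  exact: integrableB.
have iZ : P.-integrable setT Z by exact: integrable_sum.
have EZ : (\int[P]_t Z t <= 0)%E.
  rewrite integral_sum//; apply: sume_le0 => i _.
  rewrite integralB// integral_cst// mul1e [X in (_ - X)%E]probability_setT.
  by rewrite sube_le0.
have EW : (\int[P]_t W t =
    (- hX + hS + \sum_(i < n) (- hXY i + hX))%:E)%E.
  rewrite integralD//; [|exact: integrableB|exact: integrable_sum].
  rewrite integralB// Ea0 Ean integral_sum// EFinD -EFinB opprK.
  congr (_ + _)%E.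
  rewrite -sumEFin; apply: eq_bigr => i _.
  by rewrite integralB//; [rewrite (Eb i).2 Ec -EFinB opprK|exact: (Eb i).1].
(* Outside a null set all the densities involved are positive, so [ln_ratio_le] can be summed over
   [i] pointwise. *)
have WZ : \forall t \ae P, (0 <= Z t - W t)%E.
  have hq : \forall t \ae P, forall k : 'I_n.+1, 0 < q k (X t + S k t).
    by apply: filter_forall => k; exact: density_gt0_ae (mXS k) (Xq k).
  have hp : \forall t \ae P, forall i, 0 < p i (X t + Y i t).
    by apply: filter_forall => i; exact: density_gt0_ae (mXY i) (Xp i).
  apply: filterS3 (density_gt0_ae mX Xf) hp hq => t fX pXY qXS.
  have qk k : (k <= n)%N -> 0 < q (inord k) (X t + S k t).
    by move=> kn; have := qXS (inord k); rewrite inordK.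
  rewrite /Z /W; under eq_bigr do rewrite -EFinB.
  under [X in (_ - (_ + X))%E]eq_bigr do rewrite -EFinB.
  rewrite !sumEFin -!(EFinB, EFinD) lee_fin subr_ge0.
  have -> : a 0 t - a n t = \sum_(i < n) (a i t - a i.+1 t).
    rewrite -(big_mkord xpredT (fun i => a i t - a i.+1 t)) -opprB.
    rewrite -(telescope_sumr (a ^~ t))// -sumrN.
    by apply: eq_bigr => i _; rewrite opprB.
  rewrite -big_split/=; apply: ler_sum => i _.
  have := ln_ratio_le (qk i (ltnW (ltn_ord i))) (pXY i) fX
    (qk i.+1 (ltn_ord i)).
  by apply: le_trans; rewrite addrAC addrA addrAC.
(* Taking expectations gives [E W <= E Z <= 0], that is, [hS - hX] is at most the sum of the
   [hXY i - hX], each bounded by [ln (K i)]. *)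
have := ae_integral_ge0 (measurable_int _ (integrableB measurableT iZ iW)) WZ.
rewrite integralB// EW sube_ge0// => /le_trans/(_ EZ).
rewrite lee_fin.
have hle : \sum_(i < n) (hXY i - hX) <= \sum_(i < n) ln (K i).
  by apply: ler_sum => i _; rewrite lerBlDl.
have -> : \sum_(i < n) (- hXY i + hX) = - \sum_(i < n) (hXY i - hX).
  by rewrite -sumrN; apply: eq_bigr => i _; rewrite opprB addrC.
rewrite subr_le0 => W0; rewrite ln_prod//.
by rewrite -lerBlDl addrC (le_trans W0 hle).
Qed.
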